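(* Let $\varepsilon\in(0,1/2)$ be a constant. There exist constants $c>0$ and $T_0$, depending only on $\varepsilon$, such that for every $n$, every $T\ge T_0$, every $n$-variate flat polynomial $p$ with sparsity $T$, and every Boolean function $f\colon\{-1,1\}^n\to\{-1,1\}$ that is $\varepsilon$-approximated by $p$, $$\mathbb{H}(\hat f^2)\ge c\log_2 T.$$
   Context: For $S\subseteq[n]$, $\hat f(S)=\mathbb{E}_x[f(x)\prod_{i\in S}x_i]$ with $x$ uniform in $\{-1,1\}^n$. The Fourier entropy of Boolean $f$ is $\mathbb{H}(\hat f^2)=\sum_{S}\hat f(S)^2\log_2\frac{1}{\hat f(S)^2}$ (with $0\log\frac10=0$). A multilinear real polynomial $p(x)=\sum_{S\subseteq[n]}\hat p(S)\prod_{i\in S}x_i$ is flat if all its non-zero coefficients have the same magnitude; its sparsity is $|\{S:\hat p(S)\neq0\}|$. $p$ $\varepsilon$-approximates $f$ if $|p(x)-f(x)|\le\varepsilon$ for every $x\in\{-1,1\}^n$. *)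

(* Defs.v *)
From HB Require Import structures.
From mathcomp Require Import all_boot all_order all_algebra.
From mathcomp Require Import reals exp.

Set Implicit Arguments.
Unset Strict Implicit.
Unset Printing Implicit Defensive.

Import Order.TTheory GRing.Theory Num.Theory.
Local Open Scope ring_scope.

(* The cube {-1,1}^n: a point is given by its sign bits, and its i-th
   coordinate is [coord x i] = (-1)^(x i), so that [false] stands for 1 and
   [true] for -1. *)
Definition cube (n : nat) := {ffun 'I_n -> bool}.

Definition coord (R : realType) (n : nat) (x : cube n) (i : 'I_n) : R :=
  (-1) ^+ x i.

Definition chi (R : realType) (n : nat) (S : {set 'I_n}) (x : cube n) : R :=
  \prod_(i in S) coord R x i.

Definition expect (R : realType) (n : nat) (g : cube n -> R) : R :=
  (\sum_(x : cube n) g x) / #|cube n|%:R.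

Definition fourier (R : realType) (n : nat) (f : cube n -> R)
    (S : {set 'I_n}) : R :=
  expect (fun x => f x * chi R S x).

Definition is_boolean (R : realType) (n : nat) (f : cube n -> R) : Prop :=
  forall x, f x = 1 \/ f x = -1.

Definition log2 (R : realType) (a : R) : R := ln a / ln 2.

(* The convention 0 * log (1/0) = 0 holds here because [0 * a = 0] for every
   [a : R]. *)
Definition fourier_entropy (R : realType) (n : nat) (f : cube n -> R) : R :=
  \sum_(S : {set 'I_n}) fourier f S ^+ 2 * log2 (1 / fourier f S ^+ 2).

(* A multilinear real polynomial in n variables is given by its coefficients:
   [p S] is the coefficient of the monomial \prod_(i in S) x_i. *)
Definition mlpoly (R : realType) (n : nat) := {ffun {set 'I_n} -> R}.

Definition mleval (R : realType) (n : nat) (p : mlpoly R n) (x : cube n) : R :=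
  \sum_(S : {set 'I_n}) p S * chi R S x.

Definition flat (R : realType) (n : nat) (p : mlpoly R n) : Prop :=
  forall S U : {set 'I_n}, p S != 0 -> p U != 0 -> `|p S| = `|p U|.

Definition sparsity (R : realType) (n : nat) (p : mlpoly R n) : nat :=
  #|[set S : {set 'I_n} | p S != 0]|.

Definition approximates (R : realType) (n : nat) (eps : R) (p : mlpoly R n)
    (f : cube n -> R) : Prop :=
  forall x : cube n, `|mleval p x - f x| <= eps.

(* Main.v *)
Require Import Defs.
From HB Require Import structures.
From mathcomp Require Import all_boot all_order all_algebra.
From mathcomp Require Import reals exp.
From mathcomp Require Import ring lra.

(** Plancherel gives [\sum_S p S * fourier f S = E[p f] >= 1 - eps > 1/2] and
    [\sum_S p S ^+ 2 = E[p^2] <= 9/4]. By Parseval at most [sqrt T] Fourier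
    coefficients of [f] have square above [1 / sqrt T]; as [p] is flat, they
    meet only a fraction [1 / sqrt T] of the weight of [p], so they
    contribute little to the correlation. Hence the remaining coefficients of
    [f] carry a constant Fourier weight, and each of them contributes to the
    entropy its weight times at least [log2 T / 2]. *)

Set Implicit Arguments.
Unset Strict Implicit.
Unset Printing Implicit Defensive.

Import Order.TTheory GRing.Theory Num.Theory.
Local Open Scope ring_scope.

(** * Expectation over the uniform cube *)

Section Expectation.
Variables (R : realType) (n : nat).
Implicit Types (g h : cube n -> R).

Lemma card_cube_gt0 : 0 < #|cube n|%:R :> R.
Proof.
by rewrite ltr0n; apply/card_gt0P; exists [ffun=> false].
Qed.

Lemma eq_expect g h : g =1 h -> expect g = expect h.
Proof. by move=> gh; congr (_ / _); apply: eq_bigr => x _. Qed.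

Lemma expect_cst (a : R) : expect (fun _ : cube n => a) = a.
Proof.
rewrite /expect sumr_const -[a *+ _]mulr_natr mulfK //.
by rewrite gt_eqF // card_cube_gt0.
Qed.

Lemma ler_expect g h : (forall x, g x <= h x) -> expect g <= expect h.
Proof.
move=> gh; rewrite /expect ler_wpM2r ?invr_ge0 ?ler0n //.
by apply: ler_sum => x _.
Qed.

Lemma expectD g h : expect (fun x => g x + h x) = expect g + expect h.
Proof. by rewrite /expect big_split mulrDl. Qed.

Lemma expectZ (a : R) g : expect (fun x => a * g x) = a * expect g.
Proof. by rewrite /expect -mulr_sumr mulrA. Qed.

Lemma expect_sum (I : finType) (G : I -> cube n -> R) :
  expect (fun x => \sum_i G i x) = \sum_i expect (G i).
Proof. by rewrite /expect exchange_big mulr_suml. Qed.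

End Expectation.

(** * Fourier analysis of the cube, and coefficient bounds for flat polynomials *)

Section Fourier.
Variables (R : realType) (n : nat).
Implicit Types (f : cube n -> R) (p : mlpoly R n) (S U : {set 'I_n}).

(** The expectation factors over coordinates, and a coordinate lying in exactly one of [S] and [U]
    contributes the factor 1 + (-1) = 0. *)
Lemma expect_chiM S U :
  expect (fun x => chi R S x * chi R U x) = (S == U)%:R.
Proof.
have [<-|neqSU] := eqVneq S U.
  rewrite (@eq_expect _ _ _ (fun=> 1)) ?expect_cst // => x.
  rewrite /chi -big_split /= big1 // => i _.
  by rewrite /coord -expr2 sqrr_sign.
(* With the factor 1 outside [A], characters become products over all coordinates, so the sum over
   the cube turns into a product of sums over one bit. *)
pose w (A : {set 'I_n}) i (b : bool) : R := if i \in A then (-1) ^+ b else 1.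
have chiE A x : chi R A x = \prod_i w A i (x i) by rewrite /chi big_mkcond.
rewrite /expect
  (eq_bigr (fun x : cube n => \prod_i (w S i (x i) * w U i (x i)))).
  rewrite -(bigA_distr_bigA (fun i b => w S i b * w U i b)).
  have /existsP[i SUi] : [exists i, (i \in S) != (i \in U)].
    apply: contraNT neqSU; rewrite negb_exists => /forallP SU.
    by apply/eqP/setP => i; apply/eqP; have := SU i; rewrite negbK.
  rewrite (bigD1 i) //= big_bool /w.
  case: (i \in S) (i \in U) SUi => [] [] //= _;
    by rewrite expr0 expr1 !(mulr1, mul1r) addNr !mul0r.
by move=> x _; rewrite !chiE big_split.
Qed.

Lemma expect_mlevalM p f :
  expect (fun x => mleval p x * f x) = \sum_S p S * fourier f S.
Proof.
rewrite (@eq_expect _ _ _ (fun x => \sum_S p S * (f x * chi R S x))).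
  by rewrite expect_sum; apply: eq_bigr => S _; rewrite expectZ.
move=> x; rewrite /mleval mulr_suml; apply: eq_bigr => S _; ring.
Qed.

Lemma fourier_mleval p S : fourier (mleval p) S = p S.
Proof.
rewrite /fourier.
rewrite (@eq_expect _ _ _ (fun x => \sum_U p U * (chi R U x * chi R S x))).
  rewrite expect_sum (bigD1 S) //= expectZ expect_chiM eqxx mulr1.
  rewrite big1 ?addr0 // => U neqUS.
  by rewrite expectZ expect_chiM (negPf neqUS) mulr0.
by move=> x; rewrite /mleval mulr_suml; apply: eq_bigr => U _; rewrite mulrA.
Qed.

Lemma expect_mleval_sqr p :
  expect (fun x => mleval p x ^+ 2) = \sum_S p S ^+ 2.
Proof.
rewrite (@eq_expect _ _ _ (fun x => mleval p x * mleval p x)) //.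
by rewrite expect_mlevalM; apply: eq_bigr => S _; rewrite fourier_mleval.
Qed.

(** Expand [0 <= E[(f - q)^2]], where [q] is the Fourier expansion of [f]. *)
Lemma bessel f : \sum_S fourier f S ^+ 2 <= expect (fun x => f x ^+ 2).
Proof.
pose q : mlpoly R n := [ffun S => fourier f S].
have qE : \sum_S q S ^+ 2 = \sum_S fourier f S ^+ 2.
  by apply: eq_bigr => S _; rewrite ffunE.
have : 0 <= expect (fun x => (f x - mleval q x) ^+ 2).
  rewrite -[leLHS](expect_cst n); apply: ler_expect => x; exact: sqr_ge0.
rewrite (@eq_expect _ _ _ (fun x =>
  f x ^+ 2 + (mleval q x ^+ 2 + (-2) * (mleval q x * f x)))); last first.
  by move=> x; ring.
rewrite !expectD expectZ expect_mleval_sqr expect_mlevalM.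
have -> : \sum_S q S * fourier f S = \sum_S q S ^+ 2.
  by apply: eq_bigr => S _; rewrite ffunE.
by rewrite qE; lra.
Qed.

Lemma sum_fourier_sqr_le1 f :
  is_boolean f -> \sum_S fourier f S ^+ 2 <= 1.
Proof.
move=> fB; apply: le_trans (bessel f) _.
rewrite (@eq_expect _ _ _ (fun=> 1)) ?expect_cst // => x.
by case: (fB x) => ->; rewrite ?sqrrN expr1n.
Qed.

(** Pointwise, p f = 1 + (p - f) f >= 1 - eps, since f is 1 or -1. *)
Lemma approx_correlation (eps : R) p f : is_boolean f ->
  approximates eps p f -> 1 - eps <= \sum_S p S * fourier f S.
Proof.
move=> fB pf; rewrite -expect_mlevalM -[leLHS](expect_cst n).
apply: ler_expect => x; move: (pf x); rewrite ler_norml => /andP[].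
by case: (fB x) => ->; lra.
Qed.

Lemma approx_sqr_norm (eps : R) p f : is_boolean f ->
  approximates eps p f -> \sum_S p S ^+ 2 <= (1 + eps) ^+ 2.
Proof.
move=> fB pf; rewrite -expect_mleval_sqr -[leRHS](expect_cst n).
apply: ler_expect => x; move: (pf x); rewrite ler_norml => /andP[].
by case: (fB x) => ->; nra.
Qed.

(* Markov's inequality for the distribution [fourier f S ^+ 2]. *)
Lemma card_fourier_gt (f : cube n -> R) (t : R) : is_boolean f ->
  #|[set S | t < fourier f S ^+ 2]|%:R * t <= 1.
Proof.
move=> fB; apply: le_trans (sum_fourier_sqr_le1 fB).
rewrite mulr_natl -sumr_const big_mkcond /=.
apply: ler_sum => S _; rewrite inE.
by case: ifP => [/ltW|_] //; exact: sqr_ge0.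
Qed.

(** Here [a] is the common square of the non-zero coefficients, or 0 if all coefficients vanish. *)
Lemma flat_coef_sqr p : flat p ->
  exists2 a : R, forall S, p S ^+ 2 <= a
               & \sum_S p S ^+ 2 = (sparsity p)%:R * a.
Proof.
move=> pflat; have sumE a : (forall S, p S != 0 -> p S ^+ 2 = a) ->
    \sum_S p S ^+ 2 = (sparsity p)%:R * a.
  move=> pa; rewrite mulr_natl /sparsity -sumr_const.
  rewrite big_mkcond /= [RHS]big_mkcond.
  apply: eq_bigr => S _; rewrite inE.
  by have [->|/pa] := eqVneq (p S) 0; rewrite ?expr0n.
have [/existsP[U pU]|] := boolP [exists U, p U != 0].
  exists (p U ^+ 2) => [S|]; last first.
    by apply: sumE => S pS; rewrite -real_normK ?num_real //
      (pflat S U) ?real_normK ?num_real.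
  have [->|pS] := eqVneq (p S) 0; first by rewrite expr0n sqr_ge0.
  by rewrite -real_normK ?num_real // (pflat S U) ?real_normK ?num_real.
rewrite negb_exists => /forallP p0; exists 0 => [S|].
  by have := p0 S; rewrite negbK => /eqP ->; rewrite expr0n.
by apply: sumE => S; rewrite (negPf (p0 S)).
Qed.

(** No family of [#|L|] coefficients carries more than the fraction [#|L| / sparsity p] of the
    weight; the product form avoids dividing by a sparsity that may be 0. *)
Lemma flat_sum_sqr_le p (L : {set {set 'I_n}}) : flat p ->
  (\sum_(S in L) p S ^+ 2) * (sparsity p)%:R <= #|L|%:R * \sum_S p S ^+ 2.
Proof.
move=> /flat_coef_sqr[a pa ->].
rewrite mulrCA mulrC ler_wpM2l ?ler0n // mulr_natl -sumr_const.
by apply: ler_sum => S _.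
Qed.

End Fourier.

(** * Lower bounds on the entropy from small Fourier coefficients *)

Section Entropy.
Variable R : realType.

Lemma ln2_gt0 : 0 < ln 2 :> R.
Proof. by rewrite ln_gt0 // ltr1n. Qed.

Lemma entropy_term_ge (w t : R) : 0 <= w -> w <= t ->
  w * log2 (1 / t) <= w * log2 (1 / w).
Proof.
rewrite le_eqVlt => /predU1P[<-|w0] wt; first by rewrite !mul0r.
have t0 : 0 < t by exact: lt_le_trans wt.
rewrite ler_pM2l // /log2 ler_pM2r ?invr_gt0 ?ln2_gt0 //.
by rewrite ler_ln ?posrE ?divr_gt0 // !div1r lef_pV2.
Qed.

Lemma entropy_ge_sum n (f : cube n -> R) (t : R) : is_boolean f ->
  (\sum_(S | fourier f S ^+ 2 <= t) fourier f S ^+ 2) * log2 (1 / t)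
    <= fourier_entropy f.
Proof.
move=> fB; rewrite mulr_suml big_mkcond /=; apply: ler_sum => S _.
case: ifP => [|_]; first by apply: entropy_term_ge; exact: sqr_ge0.
(* A discarded term is non-negative because its weight is at most 1: this is the bound for small
   weights at threshold 1. *)
have -> : 0 = fourier f S ^+ 2 * log2 (1 / 1).
  by rewrite divr1 /log2 ln1 mul0r mulr0.
apply: entropy_term_ge; first exact: sqr_ge0.
apply: le_trans (sum_fourier_sqr_le1 fB).
by rewrite (bigD1 S) //= lerDl; apply: sumr_ge0 => U _; exact: sqr_ge0.
Qed.

Lemma log2_sqr (s : R) : 0 < s -> log2 (s ^+ 2) = 2 * log2 s.
Proof. by move=> s0; rewrite /log2 lnXn // mulr_natl mulrnAl. Qed.

(* Weighted AM-GM in place of Cauchy-Schwarz: [p f <= 2 p^2 + f^2 / 8] where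
   [f^2] is large and [p f <= p^2 / 18 + 9 f^2 / 2] where it is small. *)
Lemma small_fourier_weight n (p : mlpoly R n) (f : cube n -> R) (eps t : R) :
  eps < 1 / 2 -> is_boolean f -> approximates eps p f ->
  \sum_(S | t < fourier f S ^+ 2) p S ^+ 2 <= 1 / 16 ->
  1 / 36 <= \sum_(S | fourier f S ^+ 2 <= t) fourier f S ^+ 2.
Proof.
move=> eps2 fB pf pL.
have corr := approx_correlation fB pf.
have eps0 : 0 <= eps by apply: le_trans (pf [ffun=> false]).
have norm : \sum_S p S ^+ 2 <= 9 / 4.
  by apply: le_trans (approx_sqr_norm fB pf) _; nra.
have bess := sum_fourier_sqr_le1 fB.
have : \sum_S p S * fourier f S <=
    2 * (\sum_(S | t < fourier f S ^+ 2) p S ^+ 2)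
    + 9 / 2 * (\sum_(S | fourier f S ^+ 2 <= t) fourier f S ^+ 2)
    + 1 / 8 * (\sum_S fourier f S ^+ 2) + 1 / 18 * (\sum_S p S ^+ 2).
  rewrite !mulr_sumr.
  rewrite [X in X + _ + _ + _]big_mkcond [X in _ + X + _ + _]big_mkcond.
  rewrite -!big_split /=; apply: ler_sum => S _.
  move: (p S) (fourier f S) => a b.
  case: ltP => _.
    have := sqr_ge0 (4 * a - b); have := sqr_ge0 a; nra.
  have := sqr_ge0 (a - 9 * b); have := sqr_ge0 b; nra.
(* The three terms other than the small weight W are each at most 1/8, so 1/2 < 3/8 + (9/2) W. *)
lra.
Qed.

End Entropy.

Theorem claim5p1 (R : realType) (eps : R) (eps_gt0 : 0 < eps)
    (eps_lt : eps < 1 / 2) :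
  exists (c : R) (T0 : nat), 0 < c /\
    forall (n T : nat), (T0 <= T)%N ->
    forall p : mlpoly R n, flat p -> sparsity p = T ->
    forall f : cube n -> R, is_boolean f -> approximates eps p f ->
      c * log2 T%:R <= fourier_entropy f.
Proof.
(* The factor 1/72 is the small weight 1/36 times the 1/2 from [log2 s = log2 T / 2] with [s] the
   square root of [T]; the threshold on [T] ensures [s >= 36]. *)
exists (1 / 72), (36 ^ 2)%N; split; first by lra.
move=> n T T36 p pflat pT f fB pf.
pose s : R := Num.sqrt T%:R.
have s2 : s ^+ 2 = T%:R by rewrite sqr_sqrtr ?ler0n.
have s36 : 36 <= s.
  rewrite -(@ler_pXn2r _ 2) ?nnegrE ?sqrtr_ge0 ?ler0n //.
  by rewrite s2 -natrX ler_nat.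
have s0 : 0 < s by lra.
pose L := [set S | 1 / s < fourier f S ^+ 2].
have cardL : #|L|%:R <= s.
  have := card_fourier_gt (1 / s) fB.
  by rewrite -/L mulrA mulr1 ler_pdivrMr // mul1r.
have norm : \sum_S p S ^+ 2 <= 9 / 4.
  by apply: le_trans (approx_sqr_norm fB pf) _; nra.
have weightL : \sum_(S | 1 / s < fourier f S ^+ 2) p S ^+ 2 <= 1 / 16.
  have := flat_sum_sqr_le L pflat; rewrite pT -s2.
  rewrite (eq_bigl (fun S => 1 / s < fourier f S ^+ 2)) => [|S];
    last by rewrite inE.
  set P := \sum_(S | _) _ => Ps.
  have /(le_trans Ps) : #|L|%:R * (\sum_S p S ^+ 2) <= s * (9 / 4).
    by apply: ler_pM; rewrite ?ler0n ?sumr_ge0 // => S _; exact: sqr_ge0.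
  (* Cancelling one [s] leaves [P * s <= 9 / 4], and [s >= 36] turns this into 1/16. *)
  by rewrite expr2 mulrCA ler_pM2l //; nra.
apply: le_trans (entropy_ge_sum (1 / s) fB).
have -> : 1 / (1 / s) = s by rewrite !div1r invrK.
rewrite -s2 log2_sqr //.
have logs : 0 <= log2 s.
  by rewrite divr_ge0 ?ln_ge0 ?ltW ?ln2_gt0 //; lra.
have := small_fourier_weight eps_lt fB pf weightL.
nra.
Qed.
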